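(* Let $p>\max\{d/2,1\}$, let $U_{\mathrm{ad}}\subset L^p(\Omega)$ be nonempty, closed and convex, and assume that $J$ is Fréchet-differentiable from $V\times L^p(\Omega)$ to $\mathbb{R}$. Suppose that $\bar u\in U_{\mathrm{ad}}$ is a local optimal solution of $$\min\ J(y,u)\quad\text{s.t.}\quad y=S(u),\ \ u\in U_{\mathrm{ad}},$$ such that $\bar y=S(\bar u)$ and the associated slack function $\bar q$ satisfy the regularity assumption (R) and the active set assumption (AS) stated in the context. Then $$\partial_yJ(\bar y,\bar u)\,\eta+\partial_uJ(\bar y,\bar u)\,h\ge0\quad\text{for all }(\eta,h)\in\mathcal{T}(\bar u),$$ where the tangent cone $\mathcal{T}(\bar u)$ is the set of all $(\eta,h)\in V\times L^p(\Omega)$ for which there exist sequences $\{u_n\}\subset U_{\mathrm{ad}}$ and $\{t_n\}\subset\mathbb{R}^+$, $t_n\searrow0$, such that $$\frac{u_n-\bar u}{t_n}\rightharpoonup h\ \text{ in } L^p(\Omega)\quad\text{and}\quad\frac{S(u_n)-S(\bar u)}{t_n}\rightharpoonup\eta\ \text{ in } V.$$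
   Context: Let $\Omega\subset\mathbb{R}^d$, $d\ge1$, be a bounded domain with regular boundary satisfying the cone condition, $V:=H^1_0(\Omega)$, and let $\langle\cdot,\cdot\rangle$ be the dual pairing between $V^*$ and $V$. $A:V\to V^*$ is the linear second-order elliptic operator $$\langle Ay,v\rangle=\int_\Omega\Big(\sum_{i,j=1}^d a_{ij}\frac{\partial y}{\partial x_j}\frac{\partial v}{\partial x_i}+\sum_{i=1}^d b_i\frac{\partial y}{\partial x_i}v+\gamma yv\Big)dx$$ with $a_{ij},b_i,\gamma\in L^\infty(\Omega)$, $\gamma\ge0$, and $A$ coercive: $\langle Ay,y\rangle\ge\alpha\|y\|_V^2$ for all $y\in V$ with some $\alpha>0$. For $u\in V^*$, $S(u)=y\in V$ is the unique solution of $$\langle Ay,v-y\rangle+\int_\Omega|v|\,dx-\int_\Omega|y|\,dx\ge\langle u,v-y\rangle\quad\text{for all } v\in V.$$ The slack function $q\in L^2(\Omega)$ associated with $y=S(u)$ is the unique function with $\langle Ay,v\rangle+\int_\Omega qv\,dx=\langle u,v\rangle$ for all $v\in V$; it satisfies $q(x)y(x)=|y(x)|$ and $|q(x)|\le1$ a.e. in $\Omega$. Functions in $L^p(\Omega)$, $p>\max\{d/2,1\}$, are identified with elements of $V^*$. Local optimality of $\bar u$ means $J(S(\bar u),\bar u)\le J(S(u),u)$ for all $u\in U_{\mathrm{ad}}$ in some $L^p(\Omega)$-neighbourhood of $\bar u$. Assumption (R) for $(y,q)$: $y$ is continuous, and $q\in C(\overline\Omega)$ (continuous representatives are then used and the sets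 below are defined pointwise). Assumption (AS) for $y$: the active set $\mathcal{A}=\{x\in\Omega:y(x)=0\}$ satisfies: (1) $\mathcal{A}=\mathcal{A}_1\cup\mathcal{A}_0$, where $\mathcal{A}_1$ has positive measure and $\mathcal{A}_0$ has zero ($H^1$-)capacity. (2) $\mathcal{A}_1$ is closed, has non-empty interior, and $\mathcal{A}_1=\overline{\operatorname{int}(\mathcal{A}_1)}$. (3) For $\mathcal{J}:=\Omega\setminus\mathcal{A}_1$ it holds $\partial\mathcal{J}\setminus(\partial\mathcal{J}\cap\partial\Omega)=\partial\mathcal{A}_1\setminus(\partial\mathcal{A}_1\cap\partial\Omega)$, and both $\mathcal{A}_1$ and $\mathcal{J}$ have regular boundaries, i.e. the connected components of $\mathcal{J}$ have positive distance from each other, likewise those of $\mathcal{A}_1$, and the boundary of each component satisfies the cone condition. *)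

(* Defs.v *)
From HB Require Import structures.
From mathcomp Require Import all_boot all_order all_algebra.
From mathcomp Require Import all_classical all_reals all_analysis.
From mathcomp Require Import measurable_realfun ess_sup_inf.
From mathcomp Require Import ring lra.
Set Implicit Arguments.
Unset Strict Implicit.
Unset Printing Implicit Defensive.
Import Order.TTheory GRing.Theory Num.Theory.
Import numFieldNormedType.Exports.
Local Open Scope classical_set_scope.
Local Open Scope ring_scope.
Local Open Scope quotient_scope.

(* The sigma-algebra on 'rV[R]_n generated by the coordinates, i.e. the Borel
   sigma-algebra (see [open_measurable_rV]). *)
Definition rV_display : measure_display -> measure_display.
Proof. exact. Qed.

Section measurable_rV.
Context {R : realType} (n : nat).

Let coor (i : 'I_n) (x : 'rV[R]_n) : measurableTypeR R := x 0 i.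

Let rV0 : g_sigma_preimage coor set0.
Proof. exact: sigma_algebra0. Qed.

Let rVC A : g_sigma_preimage coor A -> g_sigma_preimage coor (~` A).
Proof. exact: sigma_algebraC. Qed.

Let rV_bigcup (F : (set _)^nat) : (forall i, g_sigma_preimage coor (F i)) ->
  g_sigma_preimage coor (\bigcup_i (F i)).
Proof. exact: sigma_algebra_bigcup. Qed.

HB.instance Definition _ := @isMeasurable.Build (rV_display default_measure_display)
  'rV[R]_n (g_sigma_preimage coor) rV0 rVC rV_bigcup.

Lemma measurable_coor (i : 'I_n) :
  measurable_fun [set: 'rV[R]_n] (coor i).
Proof.
move=> _ Y mY; rewrite setTI; apply: sub_sigma_algebra.
by rewrite (bigD1 i)//=; left; exists Y; rewrite ?setTI.
Qed.

Lemma measurable_fun_rV d (T : measurableType d) (f : T -> 'rV[R]_n) :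
  (forall i, measurable_fun [set: T] (fun t => f t 0 i : measurableTypeR R)) ->
  measurable_fun [set: T] f.
Proof.
move=> mf.
suff : g_sigma_preimage (fun i => coor i \o f) `<=` measurable.
  by rewrite g_sigma_preimage_comp => H _ A mA; apply: H; exists A.
apply: smallest_sub; first exact: sigma_algebra_measurable.
elim/big_ind : _ => //; first by move=> X Y XA YA A [/XA|/YA].
by move=> i _ A [Y mY <-]; exact: mf.
Qed.

Lemma open_measurable_rV (A : set 'rV[R]_n) : open A -> measurable A.
Proof.
move=> oA.
have mball (x : 'rV[R]_n) (e : R) : measurable (ball x e).
  have [e0|e0] := ltP 0 e; last first.
    rewrite (_ : ball x e = set0)//; apply/seteqP; split=> // y.
    by move=> [/lt_le_trans/(_ e0)]; rewrite ltxx.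
  rewrite (_ : ball x e = \bigcap_(i in [set: 'I_n]) (coor i @^-1` ball (x 0 i) e)).
    apply: fin_bigcap_measurable; first exact: finite_finset.
    move=> i _; rewrite -[X in measurable X]setTI.
    by apply: measurable_coor => //; exact: open_measurable (ball_open _ _).
  apply/seteqP; split=> [y [_ xy] i _|y xy]; first exact: xy.
  by split => // i j; rewrite (ord1 i); exact: xy.
pose F k : set 'rV[R]_n := if @unpickle ('rV[rat]_n * nat)%type k is Some qm then
   let B := ball (map_mx ratr qm.1 : 'rV[R]_n) qm.2.+1%:R^-1 in
   if pselect (B `<=` A) then B else set0 else set0.
rewrite (_ : A = \bigcup_k F k).
  apply: bigcupT_measurable => k; rewrite /F.
  by case: unpickle => [qm /=|]; [case: pselect => ?; [exact: mball|exact: measurable0]|exact: measurable0].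
apply/seteqP; split=> [x Ax|x [k _]]; last first.
  by rewrite /F; case: unpickle => [qm /=|//]; case: pselect => // BA /BA.
have /nbhs_ballP[e /= e0 xeA] := oA x Ax.
have [m me] : exists m : nat, m.+1%:R^-1 < e / 2.
  have e20 : 0 < e / 2 by rewrite divr_gt0.
  have [m _ /(_ m (leqnn m))] := near_infty_natSinv_lt (PosNum e20).
  by exists m.
have m0 : 0 < m.+1%:R^-1 :> R by rewrite invr_gt0.
have [q xq] : exists q : 'rV[rat]_n, forall i, `|x 0 i - ratr (q 0 i)| < m.+1%:R^-1.
  have H i : exists r : rat, `|x 0 i - ratr r| < m.+1%:R^-1.
    have /rat_in_itvoo[r] : x 0 i - m.+1%:R^-1 < x 0 i + m.+1%:R^-1.
      by rewrite ltrD2l gtrN.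
    rewrite in_itv/= => /andP[r1 r2]; exists r.
    by rewrite distrC ltr_distl; apply/andP.
  exists (\row_i sval (cid (H i))) => i; rewrite mxE.
  by case: cid.
have Bx : ball (map_mx ratr q : 'rV[R]_n) m.+1%:R^-1 x.
  split => // i j; rewrite (ord1 i) mxE.
  by rewrite /ball/= distrC xq.
exists (pickle (q, m)) => //; rewrite /F pickleK/=.
case: pselect => // -[] y qy; apply: xeA.
apply: le_ball (ball_triangle (ball_sym Bx) qy).
by rewrite [e]splitr lerD// ltW.
Qed.

End measurable_rV.

Section lebesgue_measure_rV.
Context {R : realType}.

Definition rV_cons n (z : 'rV[R]_n * measurableTypeR R) : 'rV[R]_n.+1 :=
  \row_i oapp (fun j => z.1 0 j) z.2 (unlift ord0 i).

Lemma measurable_rV_cons n : measurable_fun setT (@rV_cons n).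
Proof.
apply: measurable_fun_rV => i; under eq_fun do rewrite mxE.
case: (unlift ord0 i) => [j|] /=; last exact: measurable_snd.
exact: (measurableT_comp (measurable_coor j) measurable_fst).
Qed.

(* The canonical instance is spelled out because it is keyed on a proof that
   [rV_cons] is measurable, which inference cannot supply. *)
Fixpoint lebesgue_rV (n : nat) : {measure set 'rV[R]_n -> \bar R} :=
  match n with
  | 0 => dirac (0 : 'rV[R]_0)
  | m.+1 => measure_function_pushforward__canonical__measure_function_Measure
      (lebesgue_rV m \x @lebesgue_measure R)%E (@measurable_rV_cons m)
  end.

Lemma lebesgue_rV_box n (a b : 'rV[R]_n) : (forall i, a 0 i <= b 0 i) ->
  lebesgue_rV n [set x | forall i, x 0 i \in `[a 0 i, b 0 i]] =
  (\prod_(i < n) (b 0 i - a 0 i))%:E.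
Proof.
elim: n a b => [|n IHn] a b ab.
  by rewrite big_ord0 /= diracE mem_set// => -[].
pose tl (c : 'rV[R]_n.+1) : 'rV[R]_n := \row_j c 0 (lift ord0 j).
rewrite /= /pushforward.
rewrite (_ : _ @^-1` _ =
    [set x : 'rV[R]_n | forall i, x 0 i \in `[tl a 0 i, tl b 0 i]] `*`
    [set` `[a 0 ord0, b 0 ord0]]); last first.
  apply/seteqP; split=> [[x r] /= xrab|[x r] /= [xab rab] i].
    split=> [i|]; first by have := xrab (lift ord0 i); rewrite !mxE liftK.
    by have := xrab ord0; rewrite mxE unlift_none.
  rewrite mxE; case: unliftP => [j ->|->] //=.
  by have := xab j; rewrite !mxE.
rewrite product_measure1E//; last first.
  rewrite (_ : [set x | _] = \bigcap_(i in [set: 'I_n])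
      ((fun x : 'rV[R]_n => x 0 i : measurableTypeR R) @^-1`
        [set` `[tl a 0 i, tl b 0 i]])).
    apply: fin_bigcap_measurable; first exact: finite_finset.
    by move=> i _; rewrite -[X in measurable X]setTI; exact: measurable_coor.
  by apply/seteqP; split=> [x xab i _|x xab i]; exact: xab.
rewrite IHn; last by move=> i; rewrite !mxE.
rewrite [X in (_ * X)%E](lebesgue_measure_itv `[a 0 ord0, b 0 ord0])/= lte_fin big_ord_recl mulrC EFinM.
congr (_ * _)%E.
  by congr EFin; apply: eq_bigr => i _; rewrite !mxE.
case: ltP => // ba.
by rewrite (@le_anti _ _ (b 0 ord0) (a 0 ord0)) ?ba ?ab// subrr.
Qed.

End lebesgue_measure_rV.

(* [LspaceType mu p1] consists of the classes modulo equality mu-a.e.; it is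
   made a normed module here, with norm 'N[mu]_p (see [Lspace_normE]). *)
Section Lspace_normedModType.
Context d (T : measurableType d) (R : realType).
Variables (mu : {measure set T -> \bar R}) (p : \bar R) (p1 : (1 <= p)%E).

Local Notation Lsp := (LspaceType mu p1).
Local Notation M := {mfun_ mu, T >-> measurableTypeR R}.

HB.instance Definition _ := gen_eqMixin Lsp.
HB.instance Definition _ := gen_choiceMixin Lsp.

Lemma ae_eq_Lnorm (f g : T -> R) : measurable_fun setT f ->
  measurable_fun setT g -> f = g %[ae mu] ->
  'N[mu]_p[EFin \o f]%E = 'N[mu]_p[EFin \o g]%E.
Proof.
move=> mf mg fg; rewrite unlock /Lnorm; case: p p1 => [r r1|_|//].
  congr (_ `^ _)%E; apply: ae_eq_integral => //.
  - apply/measurable_EFinP; apply: (measurableT_comp (measurable_powR _)).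
    exact: measurableT_comp.
  - apply/measurable_EFinP; apply: (measurableT_comp (measurable_powR _)).
    exact: measurableT_comp.
  - by apply: filterS fg => x /(_ I) /= -> _.
case: ifPn => // _; apply: eq_ess_sup.
by apply: filterS fg => x /(_ I) /= ->.
Qed.

(* [LspaceType] and [LfunType] equip R with two distinct copies of the same
   Borel sigma-algebra, hence this cast. *)
Definition mfun_of_Lfun (f : LfunType mu p1) : {mfun T >-> measurableTypeR R} :=
  HB.pack (f : T -> measurableTypeR R)
    (isMeasurableFun.Build _ _ T (measurableTypeR R) f (measurable_funPT f)).

Lemma pi_mfun_ae (f : LfunType mu p1) :
  (\pi_M (mfun_of_Lfun f) : M) = f %[ae mu].
Proof.
by have /eqmodP/asboolP := reprK (\pi_M (mfun_of_Lfun f)).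
Qed.

Lemma pi_finite_norm (f : LfunType mu p1) :
  finite_norm mu p (\pi_M (mfun_of_Lfun f) : M).
Proof.
rewrite /finite_norm (ae_eq_Lnorm _ _ (pi_mfun_ae f)).
- exact: Lfunction_finite.
- exact: measurable_funPT (repr (\pi_M (mfun_of_Lfun f))).
- exact: measurable_funPT.
Qed.

Definition Lclass (f : LfunType mu p1) : Lsp :=
  let c := \pi_M (mfun_of_Lfun f) : M in
  HB.pack c (isFinLebesgue.Build d T R mu p p1 c (pi_finite_norm f)).

Lemma Lspace_Lfun (x : Lsp) : (x : T -> R) \in Lfun mu p.
Proof.
rewrite inE; apply/andP; split; rewrite inE/=; last exact: Lebesgue_finite.
exact: measurable_funPT (repr (x : M)).
Qed.

Definition Lrepr (x : Lsp) : LfunType mu p1 := Lfun_Sub p1 (Lspace_Lfun x).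

Lemma Lclass_ae (f : LfunType mu p1) : (Lclass f : T -> R) = f %[ae mu].
Proof. exact: pi_mfun_ae. Qed.

Lemma Lspace_inj (x y : Lsp) : (x : M) = (y : M) -> x = y.
Proof.
case: x y => [x [[cx]]] [y [[cy]]] /= xy.
by rewrite xy in cx *; rewrite (Prop_irrelevance cx cy).
Qed.

Lemma eq_Lclass (f g : LfunType mu p1) :
  (f : T -> R) = g %[ae mu] -> Lclass f = Lclass g.
Proof. by move=> fg; apply/Lspace_inj/eqmodP/asboolP. Qed.

Lemma LreprK : cancel Lrepr Lclass.
Proof.
move=> x; apply: Lspace_inj; rewrite -[RHS]reprK.
by apply/eqmodP/asboolP; exact: ae_eq_refl.
Qed.

Lemma ae_eq_LclassD (f f' g g' : LfunType mu p1) :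
  (f : T -> R) = f' %[ae mu] -> (g : T -> R) = g' %[ae mu] ->
  Lclass (f + g) = Lclass (f' + g').
Proof.
move=> ff' gg'; apply: eq_Lclass; apply: filterS2 ff' gg' => x ff' gg' _.
by rewrite [LHS]/(f x + g x) ff'// gg'.
Qed.

Lemma ae_eq_LclassZ a (f g : LfunType mu p1) :
  (f : T -> R) = g %[ae mu] -> Lclass (a *: f) = Lclass (a *: g).
Proof.
move=> fg; apply: eq_Lclass; apply: filterS fg => x fg _.
by rewrite [LHS]/(a * f x) fg.
Qed.

Let add x y := Lclass (Lrepr x + Lrepr y).
Let opp x := Lclass (- Lrepr x).
Let scale a x := Lclass (a *: Lrepr x).
Let norm (x : Lsp) : R := fine 'N[mu]_p[EFin \o x]%E.

Let addE f g : add (Lclass f) (Lclass g) = Lclass (f + g).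
Proof. by apply: ae_eq_LclassD; exact: Lclass_ae. Qed.

Let scaleE a f : scale a (Lclass f) = Lclass (a *: f).
Proof. by apply: ae_eq_LclassZ; exact: Lclass_ae. Qed.

Let oppE f : opp (Lclass f) = Lclass (- f).
Proof. by rewrite -scaleN1r -scaleE /scale scaleN1r. Qed.

Let addA : associative add.
Proof.
move=> x y z; rewrite -[x]LreprK -[y]LreprK -[z]LreprK.
by rewrite !addE addrA.
Qed.

Let addC : commutative add.
Proof. by move=> x y; rewrite /add addrC. Qed.

Let add0 : left_id (Lclass 0) add.
Proof. by move=> x; rewrite -[x]LreprK addE add0r. Qed.

Let addN : left_inverse (Lclass 0) opp add.
Proof. by move=> x; rewrite -[x]LreprK oppE addE addNr. Qed.

HB.instance Definition _ := GRing.isZmodule.Build Lsp addA addC add0 addN.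

Let scaleA a b x : scale a (scale b x) = scale (a * b) x.
Proof. by rewrite -[x]LreprK !scaleE scalerA. Qed.

Let scale1 : left_id 1 scale.
Proof. by move=> x; rewrite -[x]LreprK scaleE scale1r. Qed.

Let scaleDr : right_distributive scale +%R.
Proof.
by move=> a x y; rewrite -[x]LreprK -[y]LreprK [_ + _]addE !scaleE [RHS]addE scalerDr.
Qed.

Let scaleDl x : {morph scale^~ x : a b / a + b}.
Proof. by move=> a b; rewrite -[x]LreprK !scaleE [RHS]addE scalerDl. Qed.

HB.instance Definition _ :=
  GRing.Zmodule_isLmodule.Build R Lsp scaleA scale1 scaleDr scaleDl.

Lemma LclassD f g : Lclass (f + g) = Lclass f + Lclass g.
Proof. by rewrite -addE. Qed.

Lemma LclassZ a f : Lclass (a *: f) = a *: Lclass f.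
Proof. by rewrite -scaleE. Qed.

Lemma Lclass0 : Lclass 0 = 0. Proof. by []. Qed.

Let normE f : norm (Lclass f) = fine 'N[mu]_p[EFin \o f]%E.
Proof.
rewrite /norm (ae_eq_Lnorm _ _ (Lclass_ae f))//.
exact: measurable_funPT (Lrepr (Lclass f)).
Qed.

Let normD x y : norm (x + y) <= norm x + norm y.
Proof. by rewrite -[x]LreprK -[y]LreprK -LclassD !normE ler_LnormD. Qed.

Let normZ a x : norm (a *: x) = `|a| * norm x.
Proof.
rewrite -[x]LreprK -LclassZ !normE [in LHS]LnormZ fineM//.
by rewrite -finite_norm_fine.
Qed.

Let norm_eq0 x : norm x = 0 -> x = 0.
Proof.
move=> x0; rewrite -[x]LreprK -Lclass0; apply: eq_Lclass.
exact: fine_Lnormr_eq0.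
Qed.

HB.instance Definition _ :=
  Lmodule_isNormed.Build R Lsp normD normZ norm_eq0.

Lemma Lspace_normE (x : Lsp) : `|x| = fine 'N[mu]_p[EFin \o x]%E.
Proof. by []. Qed.

Lemma LspaceD_ae (x y : Lsp) :
  ((x + y : Lsp) : T -> R) = (fun t => x t + y t) %[ae mu].
Proof. exact: (Lclass_ae (Lrepr x + Lrepr y)). Qed.

Lemma LspaceZ_ae a (x : Lsp) : ((a *: x : Lsp) : T -> R) = (fun t => a * x t) %[ae mu].
Proof. exact: (Lclass_ae (a *: Lrepr x)). Qed.

Lemma Lspace0_ae : ((0 : Lsp) : T -> R) = cst 0 %[ae mu].
Proof. exact: (Lclass_ae 0). Qed.

End Lspace_normedModType.

Section bounded_domain.
Context {R : realType} {d : nat}.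
Implicit Types (x z xi : 'rV[R]_d) (D : set 'rV[R]_d).

Definition dotp x z : R := \sum_(i < d) x 0 i * z 0 i.
(* The library's norm on 'rV[R]_d is the max norm. *)
Definition enorm x : R := Num.sqrt (dotp x x).

(* Finite open cone with vertex x, axis xi, height h and aperture given by the
   cosine c of its half-angle. *)
Definition cone x xi h c : set 'rV[R]_d :=
  [set z | 0 < enorm (z - x) < h /\ c * enorm (z - x) < dotp (z - x) xi].

Definition cone_condition D := exists h c : R, [/\ 0 < h, 0 < c < 1 &
  forall x, D x -> exists2 xi, enorm xi = 1 & cone x xi h c `<=` D].

End bounded_domain.

Record bounded_domain (R : realType) (d : nat) := BoundedDomain {
  dom_set :> set 'rV[R]_d;
  dom_open : open dom_set;
  dom_connected : connected dom_set;
  dom_nonempty : dom_set !=set0;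
  dom_bounded : bounded_set dom_set;
  dom_cone : cone_condition dom_set }.

Arguments dom_open {R d}.

Section domain_spaces.
Context {R : realType} {d : nat} (Omega : bounded_domain R d).

Definition lebesgue_on : {measure set 'rV[R]_d -> \bar R} :=
  mrestr (lebesgue_rV d) (open_measurable_rV (dom_open Omega)).

End domain_spaces.

Notation Lp Omega p1 := (LspaceType (lebesgue_on Omega) p1).
Notation L2 Omega := (Lp Omega (lee1n 2)).
Notation Linfty Omega := (Lp Omega (leey 1)).

Section test_functions.
Context {R : realType} {d : nat}.
Implicit Types (f g phi psi : 'rV[R]_d -> R) (O : set 'rV[R]_d).

Definition partial (i : 'I_d) f : 'rV[R]_d -> R := 'D_(delta_mx 0 i) f.

Definition iter_partial (s : seq 'I_d) f : 'rV[R]_d -> R := foldr partial f s.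

Definition smooth f := forall s x, differentiable (iter_partial s f) x.

Definition test_function O phi := smooth phi /\
  exists2 K, compact K /\ K `<=` O & forall x, ~ K x -> phi x = 0.

Lemma iter_partialP a f g s : smooth f -> smooth g ->
  iter_partial s (fun x => a * f x + g x) =
  (fun x => a * iter_partial s f x + iter_partial s g x).
Proof.
move=> sf sg; elim: s => [//|i s IHs] /=; rewrite IHs; apply/funext => x.
have df : derivable (iter_partial s f) x (delta_mx 0 i) by exact: diff_derivable.
have dg : derivable (iter_partial s g) x (delta_mx 0 i) by exact: diff_derivable.
rewrite /partial.
rewrite [LHS](deriveD (f := a *: iter_partial s f))//; last exact: derivableZ.
by rewrite deriveZ.
Qed.

Lemma smoothP a f g : smooth f -> smooth g -> smooth (fun x => a * f x + g x).
Proof.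
move=> sf sg s x; rewrite iter_partialP//.
apply: (@differentiableD _ _ _ (a *: iter_partial s f)) => //.
exact: differentiableZ.
Qed.

Lemma smooth0 : smooth (fun=> 0).
Proof.
move=> s x; rewrite (_ : iter_partial s _ = cst 0); first exact: differentiable_cst.
elim: s => // i s IHs; rewrite /= IHs; apply/funext => y.
exact: derive_cst.
Qed.

Lemma test_functionP O a phi psi : test_function O phi -> test_function O psi ->
  test_function O (fun x => a * phi x + psi x).
Proof.
move=> [sphi [K [cK KO] phi0]] [spsi [L [cL LO] psi0]].
split; first exact: smoothP.
exists (K `|` L); first by split; [exact: compactU|rewrite subUset].
by move=> x /not_orP[/phi0 -> /psi0 ->]; rewrite mulr0 addr0.
Qed.

Lemma test_function0 O : test_function O (fun=> 0).
Proof.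
split; first exact: smooth0.
by exists set0 => //; split => //; exact: compact0.
Qed.

End test_functions.

Section H1_pairs.
Context {R : realType} {d : nat} (Omega : bounded_domain R d).

(* A function together with its candidate weak gradient. *)
Definition H1pair : lmodType R := (L2 Omega * {ffun 'I_d -> L2 Omega})%type.

Implicit Types w : H1pair.

Definition H1norm w : R := Num.sqrt (`|w.1| ^+ 2 + \sum_(i < d) `|w.2 i| ^+ 2).

Definition represents w (phi : 'rV[R]_d -> R) :=
  (w.1 : 'rV[R]_d -> R) = phi %[ae lebesgue_on Omega] /\
  forall i, (w.2 i : 'rV[R]_d -> R) = partial i phi %[ae lebesgue_on Omega].

Definition H10_set : set H1pair := [set w | forall e, 0 < e ->
  exists phi w', [/\ test_function Omega phi, represents w' phi &
                     H1norm (w - w') < e]].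

Definition H10_pred : {pred H1pair} := mem H10_set.

Lemma sum_CauchySchwarz (I : finType) (F G : I -> R) :
  \sum_i F i * G i <=
  Num.sqrt (\sum_i F i ^+ 2) * Num.sqrt (\sum_i G i ^+ 2).
Proof.
have Fge0 : 0 <= \sum_i F i ^+ 2 by apply: sumr_ge0 => i _; exact: sqr_ge0.
have Gge0 : 0 <= \sum_i G i ^+ 2 by apply: sumr_ge0 => i _; exact: sqr_ge0.
rewrite -sqrtrM//; apply: le_trans (ler_norm _) _; rewrite -sqrtr_sqr.
apply: ler_wsqrtr.
have : 0 <= \sum_i \sum_j (F i * G j - F j * G i) ^+ 2.
  by apply: sumr_ge0 => i _; apply: sumr_ge0 => j _; exact: sqr_ge0.
have -> : \sum_i \sum_j (F i * G j - F j * G i) ^+ 2 =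
    2 * ((\sum_i F i ^+ 2) * (\sum_i G i ^+ 2) - (\sum_i F i * G i) ^+ 2).
  transitivity (\sum_i \sum_j (F i ^+ 2 * G j ^+ 2 + G i ^+ 2 * F j ^+ 2 -
      2 * ((F i * G i) * (F j * G j)))).
    by apply: eq_bigr => i _; apply: eq_bigr => j _; ring.
  under eq_bigr do rewrite sumrB big_split/= -!mulr_sumr.
  rewrite sumrB big_split/= -!mulr_suml -mulr_sumr -mulr_suml; ring.
by rewrite pmulr_rge0// subr_ge0.
Qed.

Lemma H1norm_ge0 w : 0 <= H1norm w. Proof. exact: sqrtr_ge0. Qed.

Let H1norm_sqr_ge0 w : 0 <= `|w.1| ^+ 2 + \sum_(i < d) `|w.2 i| ^+ 2.
Proof. by rewrite addr_ge0 ?sqr_ge0// sumr_ge0// => i _; rewrite sqr_ge0. Qed.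

Let F w (o : 'I_d.+1) : R := oapp (fun i => `|w.2 i|) `|w.1| (unlift ord0 o).

Let H1normE w : H1norm w = Num.sqrt (\sum_o F w o ^+ 2).
Proof.
rewrite big_ord_recl /F unlift_none; congr (Num.sqrt (_ + _)).
by apply: eq_bigr => i _; rewrite liftK.
Qed.

Lemma H1normD w1 w2 : H1norm (w1 + w2) <= H1norm w1 + H1norm w2.
Proof.
rewrite -(@ler_pXn2r _ 2)// ?nnegrE ?addr_ge0 ?H1norm_ge0//.
apply: (@le_trans _ _ (\sum_o (F w1 o + F w2 o) ^+ 2)).
  rewrite H1normE sqr_sqrtr; last by rewrite sumr_ge0// => o _; exact: sqr_ge0.
  apply: ler_sum => o _; rewrite /F; case: unliftP => [i _|_] /=; rewrite ler_pXn2r ?nnegrE ?addr_ge0//.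
  - by rewrite ffunE ler_normD.
  - exact: ler_normD.
rewrite sqrrD !H1normE !sqr_sqrtr; [|by rewrite sumr_ge0// => o _; exact: sqr_ge0..].
under eq_bigr do rewrite sqrrD.
rewrite big_split big_split/= lerD2r lerD2l.
by rewrite sumrMnl lerMn2r sum_CauchySchwarz.
Qed.

Lemma H1normZ a w : H1norm (a *: w) = `|a| * H1norm w.
Proof.
rewrite /H1norm -sqrtr_sqr -sqrtrM ?sqr_ge0//; congr Num.sqrt.
rewrite normrZ exprMn real_normK ?num_real// mulrDr mulr_sumr; congr (_ + _).
by apply: eq_bigr => i _; rewrite ffunE normrZ exprMn real_normK ?num_real.
Qed.

Lemma H1norm_eq0 w : H1norm w = 0 -> w = 0.
Proof.
move=> /eqP; rewrite sqrtr_eq0 => w0.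
have /eqP : `|w.1| ^+ 2 + \sum_(i < d) `|w.2 i| ^+ 2 = 0.
  by apply/eqP; rewrite eq_le w0 H1norm_sqr_ge0.
rewrite paddr_eq0 ?sqr_ge0//; last by rewrite sumr_ge0// => i _; rewrite sqr_ge0.
rewrite sqrf_eq0 normr_eq0 => /andP[/eqP w10].
rewrite psumr_eq0; last by move=> i _; rewrite sqr_ge0.
move=> /allP w20; apply/eqP; rewrite -pair_eqE/=; apply/andP; split; apply/eqP => //.
apply/ffunP => i; rewrite ffunE; apply/eqP.
by have := w20 i (mem_index_enum i); rewrite sqrf_eq0 normr_eq0.
Qed.

Lemma H10_submod_closed : submod_closed H10_pred.
Proof.
split=> [|a w1 w2 /set_mem H1 /set_mem H2]; apply/mem_set => e e0.
  exists (fun=> 0), 0; split.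
  - exact: test_function0.
  - split=> [|i]; first exact: Lspace0_ae.
    have -> : partial i (fun=> 0) = cst 0 :> ('rV[R]_d -> R).
      by apply/funext => y; exact: derive_cst.
    by rewrite ffunE; exact: Lspace0_ae.
  - by rewrite subr0 -(scale0r 0) H1normZ normr0 mul0r.
have e20 : 0 < e / 2 by rewrite divr_gt0.
have a0 : 0 < `|a| + 1 by rewrite ltr_wpDl.
have [phi1 [w1' [t1 [r1 gr1] n1]]] := H1 (e / 2 / (`|a| + 1)) (divr_gt0 e20 a0).
have [phi2 [w2' [t2 [r2 gr2] n2]]] := H2 (e / 2) e20.
exists (fun x => a * phi1 x + phi2 x), (a *: w1' + w2'); split.
- exact: test_functionP.
- split=> [|i].
    apply: filterS3 (LspaceD_ae (a *: w1'.1) w2'.1) (LspaceZ_ae a w1'.1)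
      (filterI r1 r2) => x xD xZ [xr1 xr2] _.
    by rewrite [LHS]xD// xZ// xr1// xr2.
  have -> : partial i (fun x => a * phi1 x + phi2 x) =
      (fun x => a * partial i phi1 x + partial i phi2 x).
    by have [s1 _] := t1; have [s2 _] := t2; exact: (iter_partialP a [:: i] s1 s2).
  rewrite !ffunE.
  apply: filterS3 (LspaceD_ae (a *: w1'.2 i) (w2'.2 i)) (LspaceZ_ae a (w1'.2 i))
    (filterI (gr1 i) (gr2 i)) => x xD xZ [xr1 xr2] _.
  by rewrite [LHS]xD// xZ// xr1// xr2.
- have -> : a *: w1 + w2 - (a *: w1' + w2') = a *: (w1 - w1') + (w2 - w2').
    by rewrite scalerBr opprD addrACA.
  rewrite (le_lt_trans (H1normD _ _))// [e]splitr ltr_leD ?(ltW n2)// H1normZ.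
  rewrite (@le_lt_trans _ _ ((`|a| + 1) * H1norm (w1 - w1')))//.
    by rewrite ler_wpM2r ?H1norm_ge0// lerDl.
  by rewrite mulrC -ltr_pdivlMr.
Qed.

HB.instance Definition _ :=
  GRing.isSubmodClosed.Build _ _ H10_pred H10_submod_closed.

(* H^1_0(Omega), the closure of C_c^oo(Omega) for the H^1 norm, realized inside
   the pairs (y, g); the component g is the weak gradient of y and is thus
   determined by y. *)
Record H10 := MkH10 { H10_val : H1pair; H10_valP : H10_val \in H10_pred }.

HB.instance Definition _ := [isSub for H10_val].
HB.instance Definition _ := [Choice of H10 by <:].
HB.instance Definition _ := [SubChoice_isSubLmodule of H10 by <:].

Let norm (v : H10) := H1norm (H10_val v).

Let normD v1 v2 : norm (v1 + v2) <= norm v1 + norm v2.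
Proof. exact: H1normD. Qed.

Let normZ a v : norm (a *: v) = `|a| * norm v.
Proof. exact: H1normZ. Qed.

Let norm_eq0 v : norm v = 0 -> v = 0.
Proof. by move=> v0; apply: val_inj; exact: H1norm_eq0. Qed.

HB.instance Definition _ := Lmodule_isNormed.Build R H10 normD normZ norm_eq0.

Definition H10_fun (v : H10) : 'rV[R]_d -> R := (H10_val v).1.
Definition grad (v : H10) (i : 'I_d) : 'rV[R]_d -> R := (H10_val v).2 i.

End H1_pairs.

Section variational_inequality.
Context {R : realType} {d : nat} (Omega : bounded_domain R d).
Local Notation V := (H10 Omega).

Definition elliptic_form (a : 'I_d -> 'I_d -> Linfty Omega)
    (b : 'I_d -> Linfty Omega) (gamma : Linfty Omega) (y v : V) : R :=
  \int[lebesgue_on Omega]_x (\sum_(i < d) \sum_(j < d) a i j x * grad y j x * grad v i x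
    + \sum_(i < d) b i x * grad y i x * H10_fun v x
    + gamma x * H10_fun y x * H10_fun v x).

Record elliptic_operator := EllipticOperator {
  coef_a : 'I_d -> 'I_d -> Linfty Omega;
  coef_b : 'I_d -> Linfty Omega;
  coef_gamma : Linfty Omega;
  coef_gamma_ge0 : \forall x \ae lebesgue_on Omega, 0 <= coef_gamma x;
  elliptic_coercive : exists2 alpha, 0 < alpha & forall y : V,
    alpha * `|y| ^+ 2 <= elliptic_form coef_a coef_b coef_gamma y y }.

Variable A : elliptic_operator.

Definition pairA (y v : V) : R :=
  elliptic_form (coef_a A) (coef_b A) (coef_gamma A) y v.

(* Right-hand sides u in V* are given by their values v |-> <u, v>. *)
Definition solves_VI (u : V -> R) (y : V) := forall v : V,
  pairA y (v - y) + \int[lebesgue_on Omega]_x `|H10_fun v x|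
    - \int[lebesgue_on Omega]_x `|H10_fun y x| >= u (v - y).

(* For u in V* the solution exists and is unique, so the default value 0 is
   never selected. *)
Definition solution (u : V -> R) : V := xget 0 (solves_VI u).

Definition is_slack (u : V -> R) (y : V) (q : L2 Omega) := forall v : V,
  pairA y v + \int[lebesgue_on Omega]_x (q x * H10_fun v x) = u v.

Definition Lp_dual p (p1 : (1 <= p)%E) (u : Lp Omega p1) (v : V) : R :=
  \int[lebesgue_on Omega]_x (u x * H10_fun v x).

Definition control_to_state p (p1 : (1 <= p)%E) (u : Lp Omega p1) : V :=
  solution (Lp_dual u).

End variational_inequality.

Section assumptions.
Context {R : realType} {d : nat} (Omega : bounded_domain R d).
Implicit Types (D C : set 'rV[R]_d) (y : H10 Omega) (q : L2 Omega).

Definition continuous_representative D (f fc : 'rV[R]_d -> R) :=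
  {within D, continuous fc} /\ f = fc %[ae lebesgue_on Omega].

Definition assumption_R y q (yc qc : 'rV[R]_d -> R) :=
  continuous_representative Omega (H10_fun y) yc /\
  continuous_representative (closure Omega) q qc.

Definition active_set (yc : 'rV[R]_d -> R) : set 'rV[R]_d :=
  Omega `&` [set x | yc x = 0].

(* The infimum ranges over the v in H^1_0(Omega) such that v >= 1 a.e. on a
   neighbourhood of E. *)
Definition capacity (E : set 'rV[R]_d) : \bar R :=
  ereal_inf [set (`|v| ^+ 2)%:E | v in [set v : H10 Omega |
    exists U, [/\ open U, E `<=` U &
                  \forall x \ae lebesgue_on Omega, U x -> 1 <= H10_fun v x]]].

Definition boundary D : set 'rV[R]_d := closure D `\` D°.

Definition components D : set (set 'rV[R]_d) :=
  [set connected_component D x | x in D].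

Definition positive_distance D C := exists2 delta : R, 0 < delta &
  forall x z, D x -> C z -> delta <= enorm (x - z).

Definition regular_boundary D :=
  (forall C1 C2, components D C1 -> components D C2 -> C1 <> C2 ->
     positive_distance C1 C2) /\
  (forall C, components D C -> cone_condition C).

(* Topological notions about A1 are relative to Omega, so that A1 may reach the
   boundary of Omega. *)
Definition assumption_AS (yc : 'rV[R]_d -> R) := exists A1 A0 : set 'rV[R]_d,
  let Jset := Omega `\` A1 in
  [/\ [/\ active_set yc = A1 `|` A0, (0 < lebesgue_on Omega A1)%E & capacity A0 = 0],
      [/\ Omega `&` closure A1 `<=` A1, A1° !=set0 &
          A1 = Omega `&` closure A1°] &
      [/\ boundary Jset `\` (boundary Jset `&` boundary Omega) =
            boundary A1 `\` (boundary A1 `&` boundary Omega),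
          regular_boundary A1 & regular_boundary Jset]].

End assumptions.

Section optimal_control.
Context {R : realType}.

Definition weak_cvg (E : normedModType R) (x : nat -> E) (l : E) :=
  forall f : {linear E -> R^o}, continuous f -> f (x n) @[n --> \oo] --> f l.

Lemma exponent_ge1 (m p : R) : Num.max m 1 < p -> (1 <= p%:E)%E.
Proof. by rewrite gt_max lee_fin => /andP[_ /ltW]. Qed.

Context {d : nat} {Omega : bounded_domain R d} (A : elliptic_operator Omega)
  (p : \bar R) (p1 : (1 <= p)%E).
Local Notation V := (H10 Omega).
Local Notation S := (@control_to_state R d Omega A p p1).

Definition local_optimal (J : V * Lp Omega p1 -> R) (Uad : set (Lp Omega p1))
    (ubar : Lp Omega p1) := Uad ubar /\
  \forall u \near ubar, Uad u -> J (S ubar, ubar) <= J (S u, u).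

Definition tangent_cone (Uad : set (Lp Omega p1)) (ubar : Lp Omega p1) :
    set (V * Lp Omega p1) :=
  [set z | exists (u : nat -> Lp Omega p1) (t : nat -> R),
    [/\ forall n, Uad (u n), forall n, 0 < t n, t @ \oo --> 0,
        weak_cvg (fun n => (t n)^-1 *: (u n - ubar)) z.2 &
        weak_cvg (fun n => (t n)^-1 *: (S (u n) - S ubar)) z.1]].

End optimal_control.

(* Main.v *)
Require Import Defs.
From HB Require Import structures.
From mathcomp Require Import all_boot all_order all_algebra.
From mathcomp Require Import all_classical all_reals all_analysis.
From mathcomp Require Import ring lra.
Import Order.TTheory GRing.Theory Num.Theory.
Import numFieldNormedType.Exports.
Local Open Scope classical_set_scope.
Local Open Scope ring_scope.

(* By the uniform boundedness principle the difference quotients (eta_n, h_n) of a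
   tangent direction are bounded, so u_n tends strongly to ubar and optimality applies
   for large n; the remainder in the expansion of J along t_n (eta_n, h_n) is then
   o(t_n), and weak continuity of the derivative of J passes to the limit. *)

(** * Hahn-Banach extension of dominated functionals *)

(** Partial functionals are encoded by their graphs, so that extension is inclusion.
    Single-valuedness is a consequence of domination: the difference of two points above the same
    [v] lies above [0], in both signs. *)
Definition dominated_graph {R : realType} {E : normedModType R}
    (G : set (E * R)) :=
  (forall a u v, G u -> G v -> G (a *: u.1 + v.1, a * u.2 + v.2)) /\
  (forall u, G u -> u.2 <= `|u.1|).

Lemma dominated_graph_line (R : realType) (E : normedModType R) (x : E) :
  dominated_graph [set (k *: x, k * `|x|) | k in [set: R]].
Proof.
split=> [a _ _ [k _ <-] [l _ <-]|_ [k _ <-]] /=.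
  by exists (a * k + l) => //; rewrite scalerDl scalerA !mulrDl mulrA.
by rewrite normrZ ler_wpM2r// ler_norm.
Qed.

Lemma dominated_graph_bigcup (R : realType) (E : normedModType R)
    (F : set (set (E * R))) : F `<=` dominated_graph -> total_on F subset ->
  dominated_graph (\bigcup_(G in F) G).
Proof.
move=> Fdom Ftot; split=> [a u v [G FG Gu] [H FH Hv]|u [G FG]]; last exact: (Fdom G FG).2.
have [GH|HG] := Ftot _ _ FG FH.
  by exists H => //; apply: (Fdom H FH).1 => //; exact: GH.
by exists G => //; apply: (Fdom G FG).1 => //; exact: HG.
Qed.

(** By homogeneity only [k = 1] and [k = -1] constrain the value [c] at [x]: it must lie between all
    [u.2 - |u.1 - x|] and all [|u.1 + x| - u.2]. The triangle inequality puts the former below the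
    latter, so their supremum fits. *)
Lemma dominated_graph_extend (R : realType) (E : normedModType R)
    (G : set (E * R)) (x : E) : dominated_graph G -> G !=set0 ->
  exists c, dominated_graph [set (u.1 + k *: x, u.2 + k * c) | u in G & k in [set: R]].
Proof.
move=> [Glin Gdom] [u0 Gu0].
have GZ a u : G u -> G (a *: u.1, a * u.2).
  move=> Gu; have := Glin (a - 1) _ _ Gu Gu.
  by rewrite scalerBl mulrBl scale1r mul1r !subrK.
pose D := [set u.2 - `|u.1 - x| | u in G].
have Dub u : G u -> ubound D (`|u.1 + x| - u.2).
  move=> Gu _ [v Gv <-]; rewrite lerBlDr addrAC lerBrDr.
  have := Gdom _ (Glin 1 _ _ Gv Gu); rewrite /= scale1r mul1r => /le_trans; apply.
  by rewrite [leRHS]addrC (le_trans _ (ler_normD _ _))// addrACA addNr addr0.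
exists (sup D); split=> [a _ _ [u Gu [k _ <-]] [v Gv [l _ <-]]|_ [u Gu [k _ <-]]] /=.
  exists (a *: u.1 + v.1, a * u.2 + v.2); first exact: Glin.
  exists (a * k + l) => //=; congr pair.
    by rewrite scalerDl -scalerA scalerDr addrACA.
  by rewrite mulrDl -mulrA mulrDr addrACA.
have supD v : G v -> v.2 - `|v.1 - x| <= sup D <= `|v.1 + x| - v.2.
  move=> Gv; apply/andP; split.
    by apply: ub_le_sup; [exists (`|u0.1 + x| - u0.2); exact: Dub|exists v].
  by apply: ge_sup; [exists (v.2 - `|v.1 - x|), v|exact: Dub].
(* Dividing by [|k|], the lower bound on [sup D] settles negative [k] and the upper bound positive
   [k]. *)
have [k0|k0|->] := ltrgtP k 0; last by rewrite scale0r mul0r !addr0 Gdom.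
- have nk0 : 0 < - k by rewrite oppr_gt0.
  have -> : u.1 + k *: x = (- k) *: ((- k)^-1 *: u.1 - x).
    by rewrite scalerBr scalerA divff ?gt_eqF// scale1r scaleNr opprK.
  rewrite normrZ gtr0_norm//.
  have /andP[+ _] := supD _ (GZ (- k)^-1 _ Gu); rewrite /= lerBlDr.
  by rewrite -(ler_pM2l nk0) mulrA divff ?gt_eqF// mul1r; lra.
- have -> : u.1 + k *: x = k *: (k^-1 *: u.1 + x).
    by rewrite scalerDr scalerA divff ?gt_eqF// scale1r.
  rewrite normrZ gtr0_norm//.
  have /andP[_] := supD _ (GZ k^-1 _ Gu); rewrite /= lerBrDr.
  by rewrite -(ler_pM2l k0) mulrDr mulrA divff ?gt_eqF// mul1r addrC.
Qed.

(* Hahn-Banach, by Zorn's lemma on dominated graphs. A graph is only asked to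
   contain [(x, `|x|)] when it is nonempty because [Zorn_bigcup] also considers the
   empty chain. *)
Lemma norming_functional (R : realType) (E : normedModType R) (x : E) :
  exists f : {linear E -> R^o}, (forall v, `|f v| <= `|v|) /\ f x = `|x|.
Proof.
pose P (G : set (E * R)) := dominated_graph G /\ (G !=set0 -> G (x, `|x|)).
have [|A [[Adom Ax] Amax]] := @Zorn_bigcup _ P.
  move=> F FP Ftot; split.
    by apply: dominated_graph_bigcup => // G /FP[].
  by move=> [u [G FG Gu]]; exists G => //; apply: (FP _ FG).2; exists u.
have A0 : A !=set0.
  (* An empty [A] would not be maximal: the graph on the span of [x] is strictly larger. *)
  apply/set0P/eqP => A0; pose L := [set (k *: x, k * `|x|) | k in [set: R]].
  have Lx : L (x, `|x|) by exists 1; rewrite // scale1r mul1r.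
  apply: (Amax L).
    by split; [rewrite A0; exact: sub0set|rewrite A0 => /(_ _ Lx)].
  by split => // ; exact: dominated_graph_line.
have {}Ax := Ax A0.
have [Alin Aub] := Adom.
have Atot v : exists r, A (v, r).
  have [c Bdom] := dominated_graph_extend _ _ _ v Adom A0.
  set B := (X in dominated_graph X) in Bdom.
  have AB : A `<=` B.
    by move=> u Au; exists u => //; exists 0; rewrite // scale0r mul0r !addr0 -surjective_pairing.
  have Bv : B (v, c).
    exists (0, 0); last by exists 1; rewrite // scale1r mul1r !add0r.
    have := Alin (-1) _ _ Ax Ax.
    by rewrite scaleN1r mulN1r !addNr.
  exists c; apply: contrapT => nAv; apply: (Amax B); last by split => // _; exact: AB.
  by split => // /(_ _ Bv).
have A1 v r s : A (v, r) -> A (v, s) -> r = s.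
  move=> Ar As; apply/eqP; rewrite eq_le.
  have := Aub _ (Alin (-1) _ _ Ar As).
  have := Aub _ (Alin (-1) _ _ As Ar).
  by rewrite /= !mulN1r scaleN1r addNr normr0; lra.
pose f v := sval (cid (Atot v)).
have Af v : A (v, f v) by rewrite /f; case: cid.
have flin : linear (f : E -> R^o).
  by move=> a u v; apply: (A1 (a *: u + v)) => //; exact: (Alin a _ _ (Af u) (Af v)).
pose F : {linear E -> R^o} := HB.pack (f : E -> R^o) (GRing.isLinear.Build _ _ _ _ _ flin).
exists F; split; last by apply: A1 (Af x) Ax.
move=> v; rewrite ler_norml lerNl -[- _](linearN F) -[in X in X && _]normrN.
by apply/andP; split; exact: (Aub (_, _) (Af _)).
Qed.

(** * Boundedness of weakly convergent sequences *)

Lemma weak_cvg_functional_bounded (R : realType) (E : normedModType R) (x : nat -> E)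
    (l : E) (f : {linear E -> R^o}) (k : R) : weak_cvg x l ->
  (forall v, `|f v| <= k * `|v|) -> exists M, forall n, `|f (x n)| <= M.
Proof.
move=> xl fk; have /xl/cvgP/cvg_seq_bounded : continuous f.
  apply/linear_bounded_continuous/linear_boundedP.
  exists k; split; first exact: num_real.
  by move=> r /ltW kr v; rewrite (le_trans (fk v))// ler_wpM2r.
by move=> [M [_ /(_ (M + 1))]]; rewrite ltrDl ltr01 => /(_ isT) fM; exists (M + 1) => n; exact: fM.
Qed.

(* One of [f + e g] and [f - e g] works, for [g] a norming functional of [y]. *)
Lemma perturb_functional (R : realType) (E : normedModType R)
    (f : {linear E -> R^o}) (e : R) (y : E) : 0 <= e ->
  exists g : {linear E -> R^o},
    (forall v, `|g v - f v| <= e * `|v|) /\ e * `|y| <= `|g y|.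
Proof.
move=> e0; have [g [g1 gy]] := norming_functional _ _ y.
have bound (s : R) : `|s| = 1 -> forall v, `|f v + s * e * g v - f v| <= e * `|v|.
  by move=> s1 v; rewrite addrC addKr !normrM s1 mul1r ger0_norm// ler_wpM2l.
have lin (s : R) : linear (fun v => f v + s * e * g v : R^o).
  move=> a u v; rewrite !linearP /= -![_ *: _]/(_ * _); ring.
pose G s : {linear E -> R^o} := HB.pack (fun v => f v + s * e * g v : R^o)
  (GRing.isLinear.Build _ _ _ _ _ (lin s)).
have ey0 : 0 <= e * `|y| by rewrite mulr_ge0.
(* Since [g y = |y|] is nonnegative, giving [e g] the sign of [f y] prevents cancellation at [y]. *)
have [fy|fy] := leP 0 (f y).
  exists (G 1); split; first by apply: bound; rewrite normr1.
  by rewrite /G/= gy mul1r ger0_norm ?addr_ge0// lerDr.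
exists (G (-1)); split; first by apply: bound; rewrite normrN1.
by rewrite /G/= gy mulN1r mulNr ler0_norm; lra.
Qed.

(* Gliding hump: functionals [f k] with increments at most [3^-k] are chosen such
   that [f k.+1] is large at some [x n]; the later increments add up to at most
   [3^-k / 2], so their limit is still large there. *)
Lemma weak_cvg_bounded (R : realType) (E : normedModType R) (x : nat -> E) (l : E) :
  weak_cvg x l -> exists M, forall n, `|x n| <= M.
Proof.
move=> xl; apply: contrapT => unb.
have {unb} big (M : R) : exists n, M < `|x n|.
  apply: contrapT => nM; apply: unb; exists M => n.
  by rewrite leNgt; apply/negP => Mn; apply: nM; exists n.
pose e (k : nat) : R := 3^-1 ^+ k.
have e0 k : 0 < e k by rewrite exprn_gt0.
have eS k : e k.+1 = e k / 3 by rewrite /e exprSr.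
(* Half of [e k * |x (y k)|] survives the later increments; the factor 2 makes that half exceed
   [k]. *)
pose y k := sval (cid (big (2 * k%:R / e k))).
have yP k : 2 * k%:R / e k < `|x (y k)| by rewrite /y; case: cid.
pose step k (g : {linear E -> R^o}) :=
  sval (cid (perturb_functional _ _ g (e k) (x (y k)) (ltW (e0 k)))).
have stepP k g : (forall v, `|step k g v - g v| <= e k * `|v|) /\
    e k * `|x (y k)| <= `|step k g (x (y k))| by rewrite /step; case: cid.
pose f := fix f k : {linear E -> R^o} := if k is k'.+1 then step k' (f k') else \0.
have fS k v : `|f k.+1 v - f k v| <= e k * `|v| by have [] := stepP k (f k).
have fy k : e k * `|x (y k)| <= `|f k.+1 (x (y k))| by have [] := stepP k (f k).
have tail k m v : `|f (k + m)%N v - f k v| <= 3 / 2 * e k * `|v|.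
  (* This sharper bound is inductive, because [e j = 3 / 2 * (e j - e j.+1)]. *)
  suff : `|f (k + m)%N v - f k v| <= 3 / 2 * (e k - e (k + m)%N) * `|v|.
    move=> /le_trans; apply; rewrite ler_wpM2r// ler_wpM2l//.
    by rewrite gerBl ltW.
  elim: m => [|m IHm]; first by rewrite addn0 !subrr normr0 mulr0 mul0r.
  rewrite addnS -(subrKA (f (k + m)%N v)) (le_trans (ler_normD _ _))//.
  rewrite (le_trans (lerD (fS _ _) IHm))// -mulrDl ler_wpM2r// eS.
  by have := e0 (k + m)%N; lra.
have fcvg v : cvgn (fun k => f k v : R^o).
  have -> : (fun k => f k v : R^o) = series (telescope (fun k => f k v : R^o)).
    by rewrite telescopeK; apply/funext => k /=; rewrite subr0.
  apply: normed_cvg.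
  apply: (@series_le_cvg _ _ (geometric `|v| 3^-1)) => [k|k|k|].
  - exact: normr_ge0.
  - by rewrite /= mulr_ge0.
  - by rewrite /= (le_trans (fS _ _))// mulrC.
  - by apply: is_cvg_geometric_series; rewrite ger0_norm ?invf_lt1 ?ltr1n.
pose F v : R^o := limn (fun k => f k v : R^o).
have Flin : linear F.
  move=> a u v; apply: cvg_lim => //.
  under eq_fun do rewrite linearP.
  apply: cvgD (fcvg v); exact: cvgM (cvg_cst _) (fcvg u).
have Ftail k v : `|F v - f k v| <= 3 / 2 * e k * `|v|.
  have : (fun m => `|f m v - f k v|) @ \oo --> `|F v - f k v|.
    by apply: cvg_norm; apply: cvgB (fcvg v) (cvg_cst _).
  move=> /cvg_lim <-//; apply: limr_le.
    by apply/cvg_ex; exists `|F v - f k v|; apply: cvg_norm; apply: cvgB (fcvg v) (cvg_cst _).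
  by exists k => // m /= km; rewrite -(subnKC km); exact: tail.
pose FL : {linear E -> R^o} := HB.pack F (GRing.isLinear.Build _ _ _ _ _ Flin).
(* The constant is the tail bound at index 0, where [f 0] vanishes and [e 0 = 1]. *)
have [|M FM] := weak_cvg_functional_bounded _ _ _ _ FL (3 / 2) xl.
  by move=> v; have := Ftail 0%N v; rewrite /e expr0 mulr1 subr0.
(* At [x (y k)] the limit is at least [e k * |x (y k)|] minus half of it in absolute value, hence
   above [k > M]. *)
pose k := (Num.truncn M).+1.
have Mk : M < k%:R := truncnS_gt M.
have := FM (y k); have := Ftail k.+1 (x (y k)); have := fy k.
have := yP k; rewrite ltr_pdivrMr// eS -[FL _]/(F _) (distrC (F _)).
have := ler_normB (f k.+1 (x (y k)) - F (x (y k))) (- F (x (y k))).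
rewrite opprK subrK normrN [_ * e k]mulrC; lra.
Qed.

(** * Product spaces and first-order expansions *)

Lemma diff_partial_sum (R : realType) (V W U : normedModType R) (J : V * W -> U)
    (y v : V) (u h : W) : differentiable J (y, u) ->
  'd (fun y' => J (y', u)) y v + 'd (fun u' => J (y, u')) u h = 'd J (y, u) (v, h).
Proof.
move=> dJ.
have dl : is_diff y (fun y' : V => (y', u)) (fun v' => (v', 0)).
  exact: is_diff_pair.
have dr : is_diff u (fun u' : W => (y, u')) (fun h' => (0, h')).
  exact: is_diff_pair.
have -> : 'd (fun y' => J (y', u)) y v = 'd J (y, u) (v, 0).
  by rewrite -[fun y' => _]/(J \o (fun y' => (y', u))) diff_comp//= diff_val.
have -> : 'd (fun u' => J (y, u')) u h = 'd J (y, u) (0, h).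
  by rewrite -[fun u' => _]/(J \o (fun u' => (y, u'))) diff_comp//= diff_val.
by rewrite -linearD/=; congr ('d J _ (_, _)); rewrite ?addr0 ?add0r.
Qed.

(** A continuous functional on the product splits as [f (v, 0) + f (0, w)], with each summand
    continuous on its factor. *)
Lemma weak_cvg_pair (R : realType) (V W : normedModType R) (x : nat -> V)
    (y : nat -> W) (l : V) (m : W) : weak_cvg x l -> weak_cvg y m ->
  weak_cvg (fun n => (x n, y n)) (l, m).
Proof.
move=> xl ym f cf.
have lin1 : linear (fun v => f (v, 0) : R^o).
  by move=> a v w; rewrite -linearP; congr (f (_, _)); rewrite /= scaler0 addr0.
have lin2 : linear (fun w => f (0, w) : R^o).
  by move=> a v w; rewrite -linearP; congr (f (_, _)); rewrite /= scaler0 addr0.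
pose f1 : {linear V -> R^o} := HB.pack (fun v => f (v, 0) : R^o)
  (GRing.isLinear.Build _ _ _ _ _ lin1).
pose f2 : {linear W -> R^o} := HB.pack (fun w => f (0, w) : R^o)
  (GRing.isLinear.Build _ _ _ _ _ lin2).
have fE v w : f (v, w) = f1 v + f2 w.
  by rewrite /f1 /f2 /= -linearD; congr (f (_, _)); rewrite /= ?addr0 ?add0r.
rewrite fE; under eq_fun do rewrite fE.
apply: cvgD; [apply: xl|apply: ym] => v.
- apply: (@continuous_comp _ _ _ (fun v' : V => (v', 0 : W)) f); last exact: cf.
  by apply: cvg_pair; [exact: cvg_id|exact: cvg_cst].
- apply: (@continuous_comp _ _ _ (fun w' : W => (0 : V, w')) f); last exact: cf.
  by apply: cvg_pair; [exact: cvg_cst|exact: cvg_id].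
Qed.

Lemma cvg_scale_bounded (R : realType) (E : normedModType R) (t : nat -> R)
    (x : nat -> E) (M : R) : t @ \oo --> 0 -> (forall n, `|x n| <= M) ->
  (fun n => t n *: x n) @ \oo --> 0.
Proof.
move=> t0 xM; have M0 : 0 <= M := le_trans (normr_ge0 _) (xM 0%N).
apply/cvgr0Pnorm_lt => e e0.
have M1 : 0 < M + 1 by rewrite ltr_wpDl.
have /cvgr0Pnorm_lt/(_ _ (divr_gt0 e0 M1)) := t0; apply: filterS => n.
rewrite normrZ ltr_pdivlMr//; apply: le_lt_trans.
by rewrite ler_wpM2l// (le_trans (xM n))// lerDl.
Qed.

Lemma diff_quotient_bounded (R : realType) (E : normedModType R) (J : E -> R)
    (z : E) (t : nat -> R) (x : nat -> E) (M : R) :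
  differentiable J z -> (forall n, 0 < t n) -> t @ \oo --> 0 ->
  (forall n, `|x n| <= M) ->
  (fun n => (t n)^-1 * (J (z + t n *: x n) - J z) - 'd J z (x n)) @ \oo --> 0.
Proof.
move=> dJ tgt0 t0 xM; have M0 : 0 <= M := le_trans (normr_ge0 _) (xM 0%N).
have M1 : 0 < M + 1 by rewrite ltr_wpDl.
apply/cvgr0Pnorm_le => e e0.
(* The tolerance [e / (M + 1)] absorbs the factor [|x n|], which is at most [M]; the added 1 covers
   [M = 0]. *)
have /eqaddoP/(_ _ (divr_gt0 e0 M1)) oJ := diff_locally dJ.
have : \forall n \near \oo, `|(J \o shift z - (cst (J z) + 'd J z)) (t n *: x n)| <=
    e / (M + 1) * `|t n *: x n| := cvg_scale_bounded _ _ _ _ _ t0 xM _ oJ.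
apply: filterS => n /=.
rewrite -![(_ - _) _]/(_ _ - _ _) -![(_ + _) _]/(_ _ + _ _) /=.
rewrite [t n *: x n + z]addrC opprD addrA linearZ/= -[_ *: 'd J z _]/(_ * _).
have -> : (t n)^-1 * (J (z + t n *: x n) - J z) - 'd J z (x n) =
    (t n)^-1 * (J (z + t n *: x n) - J z - t n * 'd J z (x n)).
  by rewrite [RHS]mulrBr mulKf ?gt_eqF//.
rewrite normrZ normrM normfV gtr0_norm// => le_e.
rewrite ler_pdivrMl// (le_trans le_e)// mulrCA ler_wpM2l ?(ltW (tgt0 n))//.
rewrite mulrAC ler_pdivrMr// ler_wpM2l ?(ltW e0)// (le_trans (xM n))//.
by rewrite lerDl.
Qed.

(** * The inequality along tangent directions *)

Theorem theorem4p4 (R : realType) (d : nat) (d_ge1 : (1 <= d)%N)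
  (Omega : bounded_domain R d) (A : elliptic_operator Omega)
  (p : R) (hp : Num.max (d%:R / 2) 1 < p)
  (Uad : set (Lp Omega (exponent_ge1 hp)))
  (Uad_nonempty : Uad !=set0)
  (Uad_closed : closed Uad)
  (Uad_convex : convex_set (Uad : set (convex_lmodType _)))
  (J : H10 Omega * Lp Omega (exponent_ge1 hp) -> R)
  (J_differentiable : forall z, differentiable J z)
  (ubar : Lp Omega (exponent_ge1 hp))
  (ubar_optimal : local_optimal A J Uad ubar)
  (ybar : H10 Omega) (ybarE : ybar = control_to_state A ubar)
  (qbar : L2 Omega) (qbar_slack : is_slack A (Lp_dual ubar) ybar qbar)
  (yc qc : 'rV[R]_d -> R) (ybar_qbar_R : assumption_R ybar qbar yc qc)
  (ybar_AS : assumption_AS Omega yc) :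
  forall (eta : H10 Omega) (h : Lp Omega (exponent_ge1 hp)),
    tangent_cone A Uad ubar (eta, h) ->
    'd (fun y => J (y, ubar)) ybar eta + 'd (fun u => J (ybar, u)) ubar h >= 0.
Proof.
move=> eta h [u [t [uU t_gt0 t0 /= hw etaw]]].
have dJ := J_differentiable (ybar, ubar).
rewrite diff_partial_sum//.
set x := (X in weak_cvg X eta) in etaw; set k := (X in weak_cvg X h) in hw.
have xkw := weak_cvg_pair _ _ _ _ _ _ _ etaw hw.
have [M xkM] := weak_cvg_bounded _ _ _ _ xkw.
have kM n : `|k n| <= M by rewrite (le_trans _ (xkM n))// prod_normE le_max lexx orbT.
(* Controls and states are recovered exactly from their quotients, so [q n] below is the cost
   increment of the feasible pair [(S (u n), u n)] divided by [t n]. *)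
have uE n : u n = ubar + t n *: k n.
  by rewrite /k scalerA divff ?gt_eqF// scale1r addrC subrK.
have yE n : control_to_state A (u n) = ybar + t n *: x n.
  by rewrite /x scalerA divff ?gt_eqF// scale1r -ybarE addrC subrK.
pose q n : R := (t n)^-1 * (J ((ybar, ubar) + t n *: (x n, k n)) - J (ybar, ubar)).
have q_ge0 : \forall n \near \oo, 0 <= q n.
  have u_cvg : (fun n => ubar + t n *: k n) @ \oo --> ubar.
    rewrite -[X in _ --> X]addr0; apply: cvgD; first exact: cvg_cst.
    exact: cvg_scale_bounded t0 kM.
  have : \forall n \near \oo, Uad (ubar + t n *: k n) ->
    J (control_to_state A ubar, ubar) <=
    J (control_to_state A (ubar + t n *: k n), ubar + t n *: k n) :=
    u_cvg _ ubar_optimal.2.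
  apply: filterS => n; rewrite -uE => /(_ (uU n)).
  rewrite yE uE -ybarE => Jle.
  by rewrite mulr_ge0 ?invr_ge0 ?(ltW (t_gt0 n))// subr_ge0.
have q_cvg : q @ \oo --> 'd J (ybar, ubar) (eta, h).
  (* The first part is the vanishing remainder. The second converges because the derivative of [J]
     is itself a continuous functional to test weak convergence with. *)
  have -> : q = (fun n => q n - 'd J (ybar, ubar) (x n, k n) +
      'd J (ybar, ubar) (x n, k n)).
    by apply/funext => n; rewrite subrK.
  rewrite -[X in _ --> X]add0r; apply: cvgD.
    exact: diff_quotient_bounded dJ t_gt0 t0 xkM.
  exact: (xkw ('d J (ybar, ubar)) (diff_continuous dJ)).
rewrite -(cvg_lim _ q_cvg)//; apply: limr_ge => //; exact: cvgP q_cvg.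
Qed.
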